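(* Let $k\geq 2$ be an integer. Then, as an identity between formal power series, $$\log G_k=\hat G_k^{\circ},$$ where $G_k(x)=1+\sum_{n\geq 1}\frac{x^n}{n}\binom{kn}{n-1}$ and $\hat G_k^{\circ}(x)=\sum_{n\geq 1}\frac{x^n}{n!}\,|\mathscr T_k^{\circ}(n)|$ is the exponential generating function for cycle-rooted plane $k$-ary trees with vertex set $[n]$.
   Context: Here $\mathbb N=\{1,2,3,\dots\}$ and $[n]=\{1,\dots,n\}$. The logarithm of a formal power series with constant term $1$ is the usual formal logarithm. Cycle-rooted plane $k$-ary trees: let $k\ge2$ and let $V\subset\mathbb N$ be finite. A cycle-rooted plane $k$-ary tree with vertex set $V$ is a quintuple $(V,E,R,o,(\ell(v))_{v\in V})$ such that: (1) $R\subset V$ is nonempty and $E\subset\binom V2$; (2) $o$ is a cyclic permutation of $R$ (a single cycle through all elements of $R$) and $(R,E\cap\binom R2)$ is the cycle graph associated with $o$, i.e. its edges are the pairs $\{r,o(r)\}$ with $r\in R$, $r\neq o(r)$ (so there is no edge if $|R|=1$ and a single edge if $|R|=2$); (3) the graph $(V,E\setminus\binom R2,R)$ is a forest of $|R|$ trees rooted in the vertices from $R$ (each tree contains exactly one element of $R$, which is its root); (4) for each $v\in V$, the set $C(v)\subset V$ of children of $v$ in this rooted forest satisfies $|C(v)|\le k$; (5) for each $v\in V$, $\ell(v):C(v)\to\{1,\dots,k\}$ is an injective map; the $p$-th $v$-slot is said to be occupied by $j$ if $j\in C(v)$ and $\ell(v)(j)=p$, and is vacant if there is no such $j$; (6)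 for every $r\in R$, the $k$-th $r$-slot is vacant. The set of these is denoted $\mathscr T_k^\circ(V)$, and $\mathscr T_k^\circ(n):=\mathscr T_k^\circ([n])$. *)

(* Defs.v *)
From mathcomp Require Import all_boot all_order all_fingroup all_algebra.

Set Implicit Arguments.
Unset Strict Implicit.
Unset Printing Implicit Defensive.

Import GRing.Theory.
Local Open Scope ring_scope.

(* A formal power series over rat is its sequence of coefficients; equality
   of series is pointwise equality of these sequences. *)
Definition fps := nat -> rat.

Definition fps_one : fps := fun n => (n == 0%N)%:R.
Definition fps_sub (f g : fps) : fps := fun n => f n - g n.
Definition fps_mul (f g : fps) : fps :=
  fun n => \sum_(i < n.+1) f i * g (n - i)%N.
Definition fps_exp (f : fps) (m : nat) : fps := iter m (fps_mul f) fps_one.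

Lemma fps_exp_low (f : fps) (m n : nat) :
  f 0%N = 0 -> (n < m)%N -> fps_exp f m n = 0.
Proof.
move=> f0; elim: m n => // m IHm n lt_nm.
rewrite /fps_exp iterS -/(fps_exp f m) /fps_mul big1 // => -[[|i] Hi] _ /=.
  by rewrite f0 mul0r.
by rewrite IHm ?mulr0 //; case: n lt_nm Hi => // n lt_nm _;
   rewrite subSS (leq_ltn_trans (leq_subr _ _)).
Qed.

(* log f = \sum_(m >= 1) (-1)^(m-1) / m * (f - 1)^m for f with constant term
   1. By fps_exp_low only the terms with m <= n contribute to the coefficient
   of degree n. *)
Definition fps_log (f : fps) : fps := fun n =>
  \sum_(1 <= m < n.+1)
     (-1) ^+ m.-1 / m%:R * fps_exp (fps_sub f fps_one) m n.

Definition G (k : nat) : fps := fun n =>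
  if n == 0%N then 1 else n%:R^-1 * 'C(k * n, n.-1)%:R.

Local Open Scope nat_scope.

Section Graph.
Variables (V : finType) (F : {set {set V}}).

Definition pairs (A : {set V}) : {set {set V}} :=
  [set e : {set V} | (e \subset A) && (#|e| == 2)].

Definition adj : rel V := [rel u v | (u != v) && ([set u; v] \in F)].

(* A cycle of the graph is a duplicate-free cyclic sequence of at least three
   vertices; acyclicP shows that the bound on the length is harmless. *)
Definition acyclic : bool :=
  [forall m : 'I_#|V|.+1, forall c : m.-tuple V, ucycleb adj c ==> (m <= 2)].

Lemma acyclicP :
  reflect (forall c : seq V, ucycle adj c -> size c <= 2) acyclic.
Proof.
apply: (iffP forallP) => [H c uc | H m].
  have szc : size c < #|V|.+1.
    by case/andP: uc => _ uc; rewrite ltnS -(card_uniqP uc) max_card.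
  by have /forallP/(_ (in_tuple c))/implyP := H (Ordinal szc); apply.
by apply/forallP => c; apply/implyP => uc; rewrite -(size_tuple c) H.
Qed.

(* Acyclic, and every connected component contains exactly one vertex of R. *)
Definition rooted_forest (R : {set V}) : bool :=
  acyclic && [forall v, #|[set r in R | connect adj r v]| == 1].

(* w is a child of v if v comes just before w on a simple path from a root to
   w; childrenP shows that the bound on the length is harmless. *)
Definition children (R : {set V}) (v : V) : {set V} :=
  [set w | [exists r in R, exists m : 'I_#|V|, exists p : m.-tuple V,
     [&& path adj r (rcons p w), uniq (r :: rcons p w) & last r p == v]]].

Lemma childrenP (R : {set V}) (v w : V) :
  reflect (exists2 r, r \in R & exists p : seq V,
             [/\ path adj r (rcons p w), uniq (r :: rcons p w) & last r p = v])
          (w \in children R v).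
Proof.
rewrite inE; apply: (iffP exists_inP) => -[r Rr].
  by case/existsP=> m /existsP[p /and3P[pp up /eqP lp]]; exists r => //; exists p.
case=> p [pp up lp]; exists r => //.
have szp : size p < #|V|.
  have := max_card [in r :: rcons p w]; rewrite (card_uniqP up) /= size_rcons.
  exact: ltnW.
apply/existsP; exists (Ordinal szp); apply/existsP; exists (in_tuple p).
by rewrite pp up lp eqxx.
Qed.

End Graph.

Section CycleRootedTrees.
Variables (k : nat) (V : finType).
Variables (E : {set {set V}}) (R : {set V}) (o : {perm V}).
Variable (l : {ffun V -> {ffun V -> option 'I_k}}).

(* A permutation of R is represented by its extension to V that is the
   identity outside R. *)
Definition cyclic_perm_of : bool :=
  perm_on R o && [forall r in R, porbit o r == R].

Definition tree_children (v : V) : {set V} := children (E :\: pairs R) R v.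

(* The map l(v) : C(v) -> {1, ..., k} is represented by a total function with
   value None outside C(v); the value Some p stands for the slot p.+1. *)
Definition slot_map (v : V) : bool :=
  [forall j, (l v j != None) == (j \in tree_children v)]
  && dinjectiveb (l v) (tree_children v).

Definition occupied (v : V) (p : 'I_k) (j : V) : bool :=
  (j \in tree_children v) && (l v j == Some p).

Definition vacant (v : V) (p : 'I_k) : bool :=
  ~~ [exists j, occupied v p j].

Definition cycle_rooted_tree : bool :=
  [&& (R != set0) && (E \subset pairs [set: V]),
      cyclic_perm_of
        && (E :&: pairs R == [set [set r; o r] | r in R & r != o r]),
      rooted_forest (E :\: pairs R) R,
      [forall v, #|tree_children v| <= k],
      [forall v, slot_map v]
    & [forall r in R, forall p : 'I_k, (p.+1 == k) ==> vacant r p]].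

End CycleRootedTrees.

Definition cycle_rooted_trees (k : nat) (V : finType) :
    {set {set {set V}} * {set V} * {perm V}
         * {ffun V -> {ffun V -> option 'I_k}}} :=
  [set t | let: (E, R, o, l) := t in cycle_rooted_tree E R o l].

Local Open Scope ring_scope.

(* The vertex set {1, ..., n} is represented by 'I_n. *)
Definition Ghat (k : nat) : fps := fun n =>
  if n == 0%N then 0 else #|cycle_rooted_trees k 'I_n|%:R / n`!%:R.

(* Main.v *)
Require Import Defs.
From mathcomp Require Import all_boot all_order all_fingroup all_algebra.
From mathcomp Require Import ring zify.

Set Implicit Arguments.
Unset Strict Implicit.
Unset Printing Implicit Defensive.

Import GRing.Theory Num.Theory.

(* Both sides have n-th coefficient C(kn-1, n-1)/n.

   Sending every root r to the k-th slot of o r, which is vacant, and every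
   other vertex to the slot it occupies, one turns a cycle-rooted tree into an
   injection from the vertices into the kn slots whose parent function has a
   single cycle, all of whose labels are k. Such injections are built by
   choosing the slot of one vertex after the other: if m vertices have no slot
   yet and v slots are vacant, an acyclic partial choice has
   (v-1)(v-2)...(v-m+1) completions, while a partial choice whose cycle is
   already closed has d(v-1)(v-2)...(v-m+1), where d counts the vacant slots in
   the component of the cycle. Hence the number of trees on [n] is
   (kn-1)(kn-2)...(kn-n+1).

   On the analytic side, G (log G)' = G' reduces the claim to the case y = 1 of
   the Rothe-Hagen identity
     \sum_j C(kj, j) y/(y+k(n-j)) C(y+k(n-j), n-j) = C(y+kn, n). *)

(** * Reachability in the graph of a self-map *)

Section FunctionalGraph.
Variables (T : finType) (f : T -> T).

Lemma fconnect_step (x y : T) : fconnect f x y = (x == y) || fconnect f (f x) y.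
Proof.
apply/idP/orP => [/iter_findex <-|[/eqP->|]].
- case: (findex _ _ _) => [|i]; first by left.
  by right; rewrite iterSr fconnect_iter.
- exact: connect0.
- exact/connect_trans/fconnect1.
Qed.

Lemma fconnect_closed (P : pred T) (x y : T) :
  (forall z, P z -> P (f z)) -> P x -> fconnect f x y -> P y.
Proof. by move=> Pf Px /iter_findex <-; elim: (findex _ _ _) => //= i /Pf. Qed.

Lemma fconnect_fix (x y : T) : f x = x -> fconnect f x y -> y = x.
Proof.
move=> fx xy; apply/eqP.
by apply: (fconnect_closed (P := pred1 x)) xy => //= z /eqP->; rewrite fx.
Qed.

Lemma fconnect_total (x y z : T) :
  fconnect f x y -> fconnect f x z -> fconnect f y z || fconnect f z y.
Proof.
move=> /iter_findex <- /iter_findex <-.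
case/orP: (leq_total (findex f x y) (findex f x z)) => /subnK <-;
  by rewrite iterD fconnect_iter ?orbT.
Qed.

End FunctionalGraph.

Lemma fconnect_sub (T : finType) (f g : T -> T) (x y : T) :
  (forall z, fconnect g z (f z)) -> fconnect f x y -> fconnect g x y.
Proof.
move=> fg /(fconnect_closed (P := fconnect g x)); apply; last exact: connect0.
by move=> z /connect_trans; apply.
Qed.

Lemma fconnect_agree (T : finType) (f g : T -> T) (x y : T) :
  (forall z, fconnect f x z -> f z = g z) -> fconnect f x y = fconnect g x y.
Proof.
move=> fg; have it i : iter i f x = iter i g x.
  by elim: i => //= i <-; rewrite fg ?fconnect_iter.
by apply/idP/idP => /iter_findex <-; [rewrite it | rewrite -it]; exact: fconnect_iter.
Qed.

(** * Partial slot choices and their good completions *)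

Section Completions.
Variables (V S : finType) (own : S -> V) (spec : V -> S).
Hypothesis specK : cancel spec own.

Definition special (s : S) : bool := spec (own s) == s.

(* Such a c lies on the only cycle, since its own parent leads to it. *)
Definition good (psi : {ffun V -> S}) : bool :=
  injectiveb psi &&
  [exists c, [forall v, fconnect (own \o psi) v c] &&
    [forall u, fconnect (own \o psi) c u ==> special (psi u)]].

(** A vertex without a slot is its own parent, so roots are fixed points and [leads] is plain
    reachability under a total map. *)
Definition par (phi : {ffun V -> option S}) (v : V) : V :=
  if phi v is Some s then own s else v.

Definition leads (phi : {ffun V -> option S}) : rel V := fconnect (par phi).

Definition upd (phi : {ffun V -> option S}) (r : V) (s : S) :
    {ffun V -> option S} :=
  [ffun v => if v == r then Some s else phi v].

Definition vac (phi : {ffun V -> option S}) : {set S} :=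
  [set s | [forall v, phi v != Some s]].

Definition roots (phi : {ffun V -> option S}) : {set V} :=
  [set v | phi v == None].

(** For a root or a cycle vertex [x] these are the vacant slots of its component; their number
    governs the whole count. *)
Definition basin (phi : {ffun V -> option S}) (x : V) : {set S} :=
  [set s in vac phi | leads phi (own s) x].

Definition pinj (phi : {ffun V -> option S}) : Prop :=
  forall u v s, phi u = Some s -> phi v = Some s -> u = v.

Definition ext (phi : {ffun V -> option S}) : {set {ffun V -> S}} :=
  [set psi | good psi & [forall v, (phi v == None) || (phi v == Some (psi v))]].

Implicit Types (phi : {ffun V -> option S}) (psi : {ffun V -> S}).

Lemma in_basin phi x s : (s \in basin phi x) = (s \in vac phi) && leads phi (own s) x.
Proof. by rewrite inE. Qed.

Lemma ext_eq phi psi v s : psi \in ext phi -> phi v = Some s -> psi v = s.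
Proof.
by rewrite inE => /andP[_ /forallP/(_ v)] + phiv; rewrite phiv => /eqP[].
Qed.

Lemma ext_leads phi psi x y :
  psi \in ext phi -> leads phi x y -> fconnect (own \o psi) x y.
Proof.
move=> epsi; apply: fconnect_sub => z; rewrite /par.
case e: (phi z) => [s|]; last exact: connect0.
by rewrite -(ext_eq epsi e) (fconnect1 (own \o psi)).
Qed.

Lemma par_upd phi r s v :
  par (upd phi r s) v = if v == r then own s else par phi v.
Proof. by rewrite /par ffunE; case: (v == r). Qed.

Lemma par_root phi r : phi r = None -> par phi r = r.
Proof. by rewrite /par => ->. Qed.

Lemma root_leads phi r x : phi r = None -> leads phi r x -> x = r.
Proof. by move=> /par_root; apply: fconnect_fix. Qed.

Lemma leads_root_uniq phi x r q :
  phi r = None -> phi q = None -> leads phi x r -> leads phi x q -> r = q.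
Proof.
move=> r0 q0 xr xq; case/orP: (fconnect_total xr xq) => /root_leads; first by move=> ->.
by move=> ->.
Qed.

(** * The effect of one further choice *)

Section Update.
Variables (phi : {ffun V -> option S}) (r : V) (s : S).
Hypotheses (r0 : phi r = None) (s_vac : s \in vac phi).

Lemma vac_upd : vac (upd phi r s) = vac phi :\ s.
Proof.
apply/setP=> t; rewrite !inE; apply/forallP/andP => [H | [nts /forallP H] v].
  split; first by have := H r; rewrite ffunE eqxx; apply: contraNneq => ->.
  apply/forallP=> v; have := H v; rewrite ffunE.
  by case: (v =P r) => // ->; rewrite r0.
by rewrite ffunE; case: (v =P r) => // _; apply: contra nts => /eqP[->].
Qed.

Lemma roots_upd : roots (upd phi r s) = roots phi :\ r.
Proof. by apply/setP=> v; rewrite !inE ffunE; case: (v =P r). Qed.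

Lemma pinj_upd : pinj phi -> pinj (upd phi r s).
Proof.
move: s_vac; rewrite inE => /forallP sv pi u v t; rewrite !ffunE.
case: (_ =P _) => [->|_]; case: (_ =P _) => [->|_] //; last exact: pi.
  by move=> [<-] e; have := sv v; rewrite e eqxx.
by move=> e [es]; have := sv u; rewrite e es eqxx.
Qed.

(** The walk from [x] never meets [r], the only vertex whose parent changes. *)
Lemma leads_upd_far x y : ~~ leads phi x r -> leads (upd phi r s) x y = leads phi x y.
Proof.
move=> nxr; apply/esym/fconnect_agree => z xz; rewrite par_upd.
by case: (_ =P _) nxr => // <-; rewrite /leads xz.
Qed.

Lemma leads_upd_near x : leads phi x r -> leads (upd phi r s) x r.
Proof.
move=> /iter_findex; move: (findex _ _ _) => i; elim: i x => [|i IHi] x.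
  by move=> /= ->; apply: connect0.
have [-> _|nxr] := eqVneq x r; first exact: connect0.
rewrite iterSr => /IHi; rewrite /leads (fconnect_step _ x) par_upd (negbTE nxr) => ->.
by rewrite orbT.
Qed.

Lemma leads_upd_root y :
  leads (upd phi r s) r y = (r == y) || leads (upd phi r s) (own s) y.
Proof. by rewrite /leads fconnect_step par_upd eqxx. Qed.

Lemma leads_upd_closed x :
  leads phi (own s) r -> leads (upd phi r s) x r = leads phi x r.
Proof.
move=> sr; apply/idP/idP; last exact: leads_upd_near.
by apply: contraTT => nxr; rewrite leads_upd_far.
Qed.

(** A slot [s] of another component hangs the whole tree of [r] under [own s]; this tree then leads
    to [c] exactly when [own s] does. *)
Lemma leads_upd x c : ~~ leads phi (own s) r -> ~~ leads phi c r ->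
  leads (upd phi r s) x c = leads phi x c || leads phi x r && leads phi (own s) c.
Proof.
move=> nsr ncr.
have nrc : r != c by apply: contra ncr => /eqP<-; apply: connect0.
have [xr|nxr] := boolP (leads phi x r); last by rewrite leads_upd_far ?orbF.
have -> : leads phi x c = false.
  apply/negbTE; apply: contraNN ncr => xc.
  case/orP: (fconnect_total xr xc) => // /(root_leads r0) e.
  by rewrite e /leads connect0.
rewrite /= -(leads_upd_far c nsr); apply/idP/idP => [xc | sc].
  case/orP: (fconnect_total (leads_upd_near xr) xc).
    by rewrite -/(leads _ _ _) leads_upd_root (negbTE nrc).
  by rewrite -/(leads _ _ _) leads_upd_far // (negbTE ncr).
apply: connect_trans (leads_upd_near xr) _.
by rewrite -/(leads _ _ _) leads_upd_root sc orbT.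
Qed.

End Update.

(** * Recursion on the slot of a root, and choices with a closed cycle *)

Lemma ext_sum phi r : phi r = None -> pinj phi ->
  #|ext phi| = \sum_(s in vac phi) #|ext (upd phi r s)|.
Proof.
move=> r0 pi; rewrite -sum1_card.
rewrite (partition_big (fun psi : {ffun V -> S} => psi r) (mem (vac phi))) /=.
  apply: eq_bigr => s _; rewrite -sum1_card; apply: eq_bigl => psi.
  rewrite !inE -andbA; congr (_ && _); apply/andP/forallP => [[/forallP H /eqP e] v|H].
    by rewrite ffunE; case: (v =P r) => [->|_ //]; rewrite e eqxx orbT.
  split; last by have := H r; rewrite ffunE eqxx /= => /eqP[->].
  by apply/forallP=> v; have := H v; rewrite ffunE; case: (v =P r) => // ->; rewrite r0.
(* The slot of [r] is vacant in [phi]: a vertex holding it there would share it with [r] under the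
   injective [psi]. *)
move=> psi; rewrite !inE => /andP[/andP[/injectiveP inj _] /forallP H].
apply/forallP=> v; apply/eqP=> e; have := H v; rewrite e /= => /eqP[/inj e'].
by rewrite -e' r0 in e.
Qed.

Lemma ext_par phi psi v : psi \in ext phi -> phi v != None ->
  own (psi v) = par phi v.
Proof.
by move=> epsi; rewrite /par; case e: (phi v) => [s|] // _; rewrite (ext_eq epsi e).
Qed.

(* Here c lies on a cycle, so a second cycle through r is never good. *)
Lemma ext_two_cycles phi r s c : phi r = None -> leads phi (own s) r ->
  ~~ leads phi c r -> (forall u, leads phi c u -> phi u != None) ->
  ext (upd phi r s) = set0.
Proof.
move=> r0 sr ncr cdef; apply/eqP; apply/set0Pn => -[psi epsi].
have par_psi v : phi v != None -> (own \o psi) v = par phi v.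
  move=> vdef; have nvr : v == r = false by apply: contraNF vdef => /eqP->; rewrite r0.
  by rewrite /= (ext_par epsi) ?ffunE ?par_upd nvr.
have := epsi; rewrite inE => /andP[/andP[_ /existsP[d /andP[/forallP H _]]] _].
have dr : leads phi d r.
  apply: (fconnect_closed (P := leads phi ^~ r)) (H r); last exact: connect0.
  move=> z zr; have [->|nzr] := eqVneq z r.
    by rewrite /= (@ext_eq _ _ r s epsi) // ffunE eqxx.
  case e: (phi z) => [t|]; last by rewrite (root_leads e zr) eqxx in nzr.
  by rewrite par_psi ?e //; move: zr;
    rewrite /leads fconnect_step (negbTE nzr).
have cd : leads phi c d.
  apply: (fconnect_closed (P := leads phi c)) (H c); last exact: connect0.
  move=> z cz; rewrite par_psi ?cdef //.
  exact: connect_trans cz (fconnect1 _ _).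
by case/negP: ncr; apply: connect_trans dr.
Qed.

Lemma card_ext_cycle m phi c : #|roots phi| = m -> pinj phi ->
    (forall u, leads phi c u -> exists2 s, phi u = Some s & special s) ->
    leads phi (par phi c) c ->
    (forall v, leads phi v c \/ exists2 r, phi r = None & leads phi v r) ->
  #|ext phi| =
    if m is m'.+1 then #|basin phi c| * #|vac phi|.-1 ^_ m' else 1.
Proof.
elim: m phi => [|m IHm] phi roots_m pi csp cc lead.
  have def v : phi v != None.
    by apply/negP => v0; have := cards0_eq roots_m => /setP/(_ v); rewrite !inE v0.
  (* Every vertex has its slot here, so the default [spec c] is never taken. *)
  pose psi0 := [ffun v => odflt (spec c) (phi v)].
  have phiE v : phi v = Some (psi0 v).
    by have := def v; rewrite ffunE; case: (phi v).
  have lead_psi : par phi =1 own \o psi0 by move=> v; rewrite /par phiE.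
  rewrite -(cards1 psi0); congr #|pred_of_set _|; apply/setP=> psi; rewrite !inE.
  apply/andP/eqP => [[_ /forallP H]|->].
    by apply/ffunP=> v; have := H v; rewrite phiE => /eqP[].
  split; last by apply/forallP=> v; rewrite phiE eqxx orbT.
  apply/andP; split.
    by apply/injectiveP => u v e; apply: pi (phiE u) _; rewrite e.
  apply/existsP; exists c; apply/andP; split; apply/forallP => v.
    rewrite -(eq_fconnect lead_psi); case: (lead v) => // -[r r0 _].
    by have := def r; rewrite r0.
  apply/implyP; rewrite -(eq_fconnect lead_psi) => /csp[s].
  by rewrite phiE => -[->].
have [r] : exists r, r \in roots phi by apply/card_gt0P; rewrite roots_m.
rewrite inE => /eqP r0.
have cdef u : leads phi c u -> phi u != None by move=> /csp[s -> _].
have ncr : ~~ leads phi c r by apply/negP => /cdef; rewrite r0.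
have nrc : r != c by apply: contra ncr => /eqP<-; apply: connect0.
have disj x : leads phi x c -> ~~ leads phi x r.
  move=> xc; apply/negP => xr; case/orP: (fconnect_total xc xr); first exact/negP.
  by move/(root_leads r0) => e; rewrite e eqxx in nrc.
rewrite (ext_sum r0 pi).
have step s : s \in vac phi -> ~~ leads phi (own s) r ->
    #|ext (upd phi r s)| = if m is m'.+1
      then #|basin (upd phi r s) c| * #|vac phi|.-2 ^_ m' else 1.
  move=> sv nsr.
  rewrite (IHm (upd phi r s)).
  - by case: (m) => // m'; rewrite vac_upd // (cardsD1 s (vac phi)) sv.
  - by have := cardsD1 r (roots phi); rewrite roots_upd roots_m inE r0 eqxx => -[].
  - exact: pinj_upd.
  - move=> u; rewrite leads_upd_far // => cu; have [t tu st] := csp u cu.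
    exists t => //; rewrite ffunE; case: (_ =P _) => // e; by rewrite e r0 in tu.
  - rewrite par_upd eq_sym (negbTE nrc) leads_upd_far //.
    by apply: contra ncr; apply: connect_trans; apply: fconnect1.
  - move=> v; have go x : ~~ leads phi x r ->
        leads (upd phi r s) x c \/
        exists2 q, upd phi r s q = None & leads (upd phi r s) x q.
      move=> nxr; case: (lead x) => [xc|[q q0 xq]].
        by left; rewrite leads_upd_far.
      right; exists q; last by rewrite leads_upd_far.
      by rewrite ffunE; case: (_ =P _) => // e; rewrite -e xq in nxr.
    have [vr|nvr] := boolP (leads phi v r); last exact: go.
    have vs : leads (upd phi r s) v (own s).
      apply: connect_trans (leads_upd_near s vr) _.
      by rewrite -/(leads _ _ _) leads_upd_root /leads connect0 orbT.
    case: (go _ nsr) => [sc|[q q0 sq]]; first by left; apply: connect_trans vs sc.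
    by right; exists q => //; apply: connect_trans vs sq.
have basin_sub x : basin phi x \subset vac phi.
  by apply/subsetP => s; rewrite inE => /andP[].
have dsub : basin phi c \subset vac phi :\: basin phi r.
  by apply/subsetP => s; rewrite !inE => /andP[-> /disj/negbTE->].
have card_vac := cardsID (basin phi r) (vac phi).
have card_vac' := cardsID (basin phi c) (vac phi :\: basin phi r).
rewrite (setIidPr (basin_sub _)) in card_vac.
rewrite (setIidPr dsub) in card_vac'.
rewrite (big_setID (basin phi r)) /= big1 ?add0n => [|s]; last first.
  rewrite inE => /andP[_]; rewrite inE => /andP[sv sr].
  by rewrite (ext_two_cycles r0 sr ncr cdef) cards0.
rewrite (big_setID (basin phi c)) /= (setIidPr dsub).
(* Now [r] hangs in the component of [c]: the two basins merge and [s] is used up. *)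
have basin_c s : s \in basin phi c ->
    #|basin (upd phi r s) c| = (#|basin phi c| + #|basin phi r|).-1.
  rewrite inE => /andP[sv sc].
  have -> : basin (upd phi r s) c = (basin phi c :|: basin phi r) :\ s.
    apply/setP=> t; rewrite inE vac_upd // (leads_upd r0 _ (disj _ sc) ncr) sc andbT.
    by rewrite !inE -andbA -andb_orr.
  have := cardsD1 s (basin phi c :|: basin phi r).
  rewrite in_setU in_basin sv sc /= => e.
  rewrite -cardsUI (_ : _ :&: _ = set0) ?cards0 ?addn0 ?e //.
  by apply/setP=> t; rewrite !inE; case: (boolP (leads phi (own t) c)) => [/disj/negbTE->|];
    rewrite ?andbF.
have basin_o s : s \in (vac phi :\: basin phi r) :\: basin phi c ->
    #|basin (upd phi r s) c| = #|basin phi c|.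
  rewrite !in_setD !in_basin.
  case: (boolP (s \in vac phi)) => //= sv; rewrite andbT => /andP[nsc nsr].
  apply: eq_card => t; rewrite inE vac_upd // (leads_upd r0 _ nsr ncr) !inE.
  rewrite (negbTE nsc) andbF orbF.
  by have [->|//] := eqVneq t s; rewrite (negbTE nsc) !andbF.
(* In the first case [r] is the only root, so no vacant slot lies outside the two basins. *)
case: m IHm roots_m step => [|m] IHm roots_m step.
  rewrite [X in _ + X]big1 => [|s].
    rewrite addn0 muln1 -sum1_card; apply: eq_bigr => s.
    by rewrite inE => /andP[sv sc]; rewrite step ?disj.
  rewrite !in_setD !in_basin; case: (boolP (s \in vac phi)) => //= sv.
  rewrite andbT => /andP[nsc nsr]; case: (lead (own s)) => [sc|[q q0 sq]].
    by rewrite sc in nsc.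
  have : q \in roots phi by rewrite inE q0.
  move/eqP/cards1P: roots_m => [r' e]; have : r \in roots phi by rewrite inE r0.
  by rewrite e !inE => /eqP <- /eqP eq_r; rewrite -eq_r sq in nsr.
rewrite (eq_bigr (fun=> (#|basin phi c| + #|basin phi r|).-1
                        * #|vac phi|.-2 ^_ m)); last first.
  by move=> s sc; rewrite -(basin_c s sc) step //; move: sc; rewrite inE => /andP[// _ /disj].
rewrite sum_nat_const.
rewrite (eq_bigr (fun=> #|basin phi c| * #|vac phi|.-2 ^_ m)); last first.
  move=> s so; rewrite -(basin_o s so) step //; move: so; rewrite !in_setD !in_basin;
  by case: (s \in vac phi); rewrite ?andbF //= andbT => /andP[].
rewrite sum_nat_const ffactnS.
move: card_vac card_vac'; set d := #|basin phi c|; set e := #|basin phi r|.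
set X := _ ^_ m; move: #|_ :\: _| #|_ :\: _| => a b <- <-.
by case: d => [|d]; rewrite ?mul0n ?muln0 //; nia.
Qed.

(** * Closing a cycle of special slots *)

Lemma ext_upd_sub phi r s : phi r = None -> ext (upd phi r s) \subset ext phi.
Proof.
move=> r0; apply/subsetP => psi; rewrite !inE => /andP[-> /forallP H].
apply/forallP => v; have := H v; rewrite ffunE.
by have [->|//] := eqVneq v r; rewrite r0.
Qed.

Lemma leads_pred phi x q : leads phi x q -> x != q ->
  exists z, [/\ leads phi x z, par phi z = q & z != q].
Proof.
move=> /iter_findex; move: (findex _ _ _) => i; elim: i x => [|i IHi] x.
  by move=> /= ->; rewrite eqxx.
rewrite iterSr => /IHi IH nxq; have [pxq|/IH[z [xz zq nzq]]] := eqVneq (par phi x) q.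
  by exists x; split => //; apply: connect0.
by exists z; split => //; rewrite /leads fconnect_step [fconnect _ _ _]xz orbT.
Qed.

(** If [x] and [y] differed, leading to both would be inherited along the walk to [r]; but the fixed
    point [r] leads only to itself. *)
Lemma leads_anti phi x y r : phi r = None -> leads phi x r ->
  leads phi x y -> leads phi y x -> x = y.
Proof.
move=> r0 xr xy yx; apply/eqP; apply: contraT => nxy.
have : leads phi r x && leads phi r y.
  apply: (fconnect_closed (P := fun z => leads phi z x && leads phi z y)) xr.
    move=> z /andP[]; rewrite /leads !(fconnect_step _ z).
    case/orP=> [/eqP->|zx]; first rewrite (negbTE nxy) /= => h.
      by rewrite h (connect_trans h yx).
    by case/orP=> [/eqP e|->]; rewrite zx // -e (connect_trans zx) // e.
  by rewrite xy /leads connect0.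
by case/andP=> /(root_leads r0) ex /(root_leads r0) ey; rewrite ex ey eqxx in nxy.
Qed.

Definition special_from phi x : bool :=
  [forall u, leads phi x u ==> if phi u is Some t then special t else true].

(* The slots of the component of r that close a cycle of special slots when
   given to r; there is one, at the end of the chain of special slots below r. *)
Definition closers phi (r : V) : {set S} :=
  [set s in basin phi r | special s && special_from phi (own s)].

Lemma special_fromP phi x u t :
  special_from phi x -> leads phi x u -> phi u = Some t -> special t.
Proof. by move=> /forallP/(_ u)/implyP H /H + e; rewrite e. Qed.

(** Among the vertices joined to [r] by special slots, take [x] reaching the most vertices: an
    occupant of [spec x] would reach one more. *)
Lemma chain_end_ex phi r : phi r = None ->
  exists x, [/\ leads phi x r, special_from phi x & spec x \in vac phi].
Proof.
move=> r0; pose P x := leads phi x r && special_from phi x.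
have Pr : P r.
  apply/andP; split; first exact: connect0.
  by apply/forallP => u; apply/implyP => /(root_leads r0) ->; rewrite r0.
case: (@arg_maxnP _ r P (fun x => #|leads phi x|) Pr) => x /andP[xr spx] xmax.
exists x; split => //; rewrite inE; apply/forallP => u; apply/negP => /eqP eu.
have pu : par phi u = x by rewrite /par eu specK.
have ux : leads phi u x by rewrite -pu; exact: fconnect1.
have Pu : P u.
  apply/andP; split; first exact: connect_trans ux xr.
  apply/forallP => w; apply/implyP; rewrite /leads fconnect_step pu.
  case/orP=> [/eqP<-|xw]; first by rewrite eu /special specK.
  by move/forallP/(_ w)/implyP: spx; apply.
have := xmax u Pu; apply/negP; rewrite -ltnNge; apply: proper_card.
apply/properP; split; first by apply/subsetP => w; apply: connect_trans.
exists u; first exact: connect0.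
apply/negP => xu; have exu := leads_anti r0 xr xu ux; rewrite exu in pu xr.
by rewrite -(fconnect_fix pu xr) r0 in eu.
Qed.

(** The chain of special slots does not branch. By induction on the distance from [w] to [r], the
    walk from [x] passes through [par phi w]; the vertex just before it holds the special slot of
    [par phi w], as [w] does, hence is [w]. *)
Lemma chain_end_leads phi r x w : phi r = None -> pinj phi ->
    leads phi x r -> special_from phi x -> spec x \in vac phi ->
  leads phi w r -> special_from phi w -> leads phi x w.
Proof.
move=> r0 pi xr spx; rewrite inE => /forallP xvac.
move=> /iter_findex; move: (findex _ _ _) => i; elim: i w => [|i IHi] w.
  by move=> /= ->.
rewrite iterSr => iw spw.
have xq : leads phi x (par phi w).
  apply: IHi => //; apply/forallP => u; apply/implyP => wu.
  move/forallP/(_ u)/implyP: spw; apply.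
  by rewrite /leads fconnect_step; apply/orP; right.
case ew: (phi w) => [t|]; last by move: xq; rewrite (par_root ew).
have st : special t by apply: special_fromP spw _ ew; apply: connect0.
have pw : par phi w = own t by rewrite /par ew.
rewrite pw in xq.
have nxq : x != own t.
  by apply/negP => /eqP e; have := xvac w; rewrite ew e (eqP st) eqxx.
have [z [xz zq nzq]] := leads_pred xq nxq.
case ez: (phi z) => [t'|]; last by rewrite -zq (par_root ez) eqxx in nzq.
have st' : special t' by apply: special_fromP spx xz ez.
suff tt' : t' = t by rewrite (pi w z t) // -tt'.
by rewrite -(eqP st') -(eqP st) -zq /par ez.
Qed.

(** Two chain ends lead to each other and so coincide; the closer is the special slot of this
    end. *)
Lemma card_closers phi r : phi r = None -> pinj phi -> #|closers phi r| = 1.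
Proof.
move=> r0 pi; have [x [xr spx xvac]] := chain_end_ex r0.
apply/eqP/cards1P; exists (spec x); apply/setP => s.
rewrite in_set1 !in_set; apply/andP/eqP => [[/andP[sv sr] /andP[ss sps]]|->].
  have sv' : spec (own s) \in vac phi by rewrite (eqP ss) inE.
  rewrite -(eqP ss); congr spec; apply: (leads_anti r0 sr).
    exact: (chain_end_leads r0 pi sr sps sv' xr spx).
  exact: (chain_end_leads r0 pi xr spx xvac sr sps).
by move: xvac; rewrite inE => ->; rewrite specK xr spx /special specK eqxx.
Qed.

(** The choice closes the cycle from [r] through [own s] back to [r]. In a good completion this
    cycle has only special slots, which would make [s] a closer. *)
Lemma ext_not_closer phi r s : phi r = None -> s \in basin phi r ->
  s \notin closers phi r -> ext (upd phi r s) = set0.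
Proof.
move=> r0 sb; apply: contraNeq => /set0Pn[psi epsi].
have epsi' : psi \in ext phi by apply: subsetP epsi; apply: ext_upd_sub.
have psir : psi r = s by apply: ext_eq epsi _; rewrite ffunE eqxx.
rewrite inE sb /=; move: sb; rewrite in_basin => /andP[sv sr].
have := epsi'; rewrite inE.
case/andP=> [/andP[_ /existsP[d /andP[/forallP H /forallP spd]]] _].
have dr : leads phi d r.
  apply: (fconnect_closed (P := leads phi ^~ r)) (H r); last exact: connect0.
  move=> z zr; have [->|nzr] := eqVneq z r; first by rewrite /= psir.
  case e: (phi z) => [t|]; last by rewrite (root_leads e zr) eqxx in nzr.
  by rewrite /= (ext_par epsi') ?e //; move: zr;
    rewrite /leads fconnect_step (negbTE nzr).
have dr' := ext_leads epsi' dr.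
have sps u : fconnect (own \o psi) d u -> special (psi u) by apply/implyP.
rewrite -{1}psir sps //=; apply/forallP => u; apply/implyP => su.
case eu: (phi u) => [t|//]; rewrite -(ext_eq epsi' eu); apply: sps.
apply: connect_trans dr' _; rewrite fconnect_step /= psir.
by rewrite (ext_leads epsi' su) orbT.
Qed.

(** This is [card_ext_cycle] for the cycle through [r]: the component of [r] is unchanged except
    that [s] is no longer vacant. *)
Lemma card_ext_closer phi r s m : #|roots phi| = m.+1 -> pinj phi ->
    (forall v, exists2 r, phi r = None & leads phi v r) ->
    phi r = None -> s \in closers phi r ->
  #|ext (upd phi r s)| =
    if m is m'.+1 then #|basin phi r|.-1 * #|vac phi|.-2 ^_ m' else 1.
Proof.
move=> roots_m pi lead r0; rewrite in_set in_basin => /and3P[/andP[sv sr] ss sps].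
rewrite (@card_ext_cycle m _ r).
- case: m roots_m => // m roots_m; rewrite vac_upd // (cardsD1 s (vac phi)) sv.
  congr (_ * _); rewrite (cardsD1 s (basin phi r)) in_basin sv sr; apply: eq_card => t.
  by rewrite in_basin vac_upd // in_setD1 leads_upd_closed // in_setD1 in_basin andbA.
- by have := cardsD1 r (roots phi); rewrite roots_upd roots_m inE r0 eqxx => -[].
- exact: pinj_upd.
- move=> u; rewrite leads_upd_root.
  case: (eqVneq r u) => [<- _|nru /= su]; first by exists s; rewrite ?ffunE ?eqxx.
  rewrite ffunE eq_sym (negbTE nru).
  have su' : leads phi (own s) u.
    apply: (fconnect_closed (P := leads phi (own s))) su; last exact: connect0.
    move=> z sz; rewrite par_upd; case: ifP => _; first exact: connect0.
    exact: connect_trans sz (fconnect1 _ _).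
  case/orP: (fconnect_total sr su').
    by move/(root_leads r0) => e; rewrite e eqxx in nru.
  move=> ur; case eu: (phi u) => [t|]; last by rewrite (root_leads eu ur) eqxx in nru.
  by exists t => //; apply: special_fromP sps su' eu.
- by rewrite par_upd eqxx leads_upd_near.
- move=> v; have [q q0 vq] := lead v.
  have [<-|nqr] := eqVneq q r; first by left; rewrite leads_upd_near.
  right; exists q; first by rewrite ffunE (negbTE nqr).
  rewrite leads_upd_far //; apply/negP => vr.
  by rewrite (leads_root_uniq q0 r0 vq vr) eqxx in nqr.
Qed.

(** Let [b] be the size of the basin of the chosen root and [v] the number of vacant slots. Inside
    the basin only the unique closer contributes, with factor [b - 1]; each of the [v - b] slots
    outside keeps the choice acyclic and contributes with factor 1. The total factor is (b-1) +
    (v-b) = v-1. *)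
Lemma card_ext_acyclic m phi : #|roots phi| = m.+1 -> pinj phi ->
    (forall v, exists2 r, phi r = None & leads phi v r) ->
  #|ext phi| = #|vac phi|.-1 ^_ m.
Proof.
elim: m phi => [|m IHm] phi roots_m pi lead;
  (have [r] : exists r, r \in roots phi by apply/card_gt0P; rewrite roots_m);
  rewrite inE => /eqP r0; rewrite (ext_sum r0 pi);
  have csub : closers phi r \subset basin phi r
    by apply/subsetP => s; rewrite inE => /andP[].
all: have bsub : basin phi r \subset vac phi
    by apply/subsetP => s; rewrite inE => /andP[].
all: rewrite (big_setID (basin phi r)) /= (setIidPr bsub) (big_setID (closers phi r)) /=.
all: rewrite (setIidPr csub) [X in _ + X + _]big1 ?addn0;
  last by move=> s; rewrite inE => /andP[nsc sb]; rewrite (ext_not_closer r0 sb nsc) cards0.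
  rewrite [X in _ + X]big1 => [|s].
    rewrite (eq_bigr (fun=> 1)) ?sum1_card ?card_closers // => s sc.
    exact: (card_ext_closer roots_m pi lead r0 sc).
  rewrite in_setD in_basin; case: (boolP (s \in vac phi)) => //= sv; rewrite andbT => nsr.
  have [q q0 sq] := lead (own s).
  have : q \in roots phi by rewrite inE q0.
  move/eqP/cards1P: roots_m => [r' e]; have : r \in roots phi by rewrite inE r0.
  by rewrite e !inE => /eqP <- /eqP eq_r; rewrite -eq_r sq in nsr.
rewrite (eq_bigr (fun=> #|basin phi r|.-1 * #|vac phi|.-2 ^_ m)); last first.
  by move=> s sc; exact: (card_ext_closer roots_m pi lead r0 sc).
rewrite sum_nat_const card_closers // mul1n.
rewrite (eq_bigr (fun=> #|vac phi|.-2 ^_ m)); last first.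
  move=> s; rewrite in_setD in_basin.
  case: (boolP (s \in vac phi)) => //= sv; rewrite andbT => nsr.
  rewrite (IHm (upd phi r s)).
  - by rewrite vac_upd // (cardsD1 s (vac phi)) sv.
  - by have := cardsD1 r (roots phi); rewrite roots_upd roots_m inE r0 eqxx => -[].
  - exact: pinj_upd.
  - move=> v; have go x : ~~ leads phi x r ->
        exists2 q, upd phi r s q = None & leads (upd phi r s) x q.
      move=> nxr; have [q q0 xq] := lead x.
      exists q; last by rewrite leads_upd_far.
      by rewrite ffunE; have [e|] := eqVneq q r => //; rewrite -e xq in nxr.
    have [vr|nvr] := boolP (leads phi v r); last exact: go.
    have [q q0 sq] := go _ nsr; exists q => //.
    apply: connect_trans (leads_upd_near s vr) _.
    by rewrite -/(leads _ _ _) leads_upd_root sq orbT.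
rewrite sum_nat_const -mulnDl ffactnS; congr (_ * _).
have := cardsID (basin phi r) (vac phi); rewrite (setIidPr bsub) => <-.
(* The basin contains the closer, so its predecessor is not truncated. *)
have : 0 < #|basin phi r|.
  by apply: leq_trans (subset_leq_card csub); rewrite card_closers.
by case: #|basin phi r| => //= b _; rewrite addSn.
Qed.

Lemma card_good : 0 < #|V| -> #|[set psi | good psi]| = #|S|.-1 ^_ #|V|.-1.
Proof.
move=> V_gt0; pose phi0 : {ffun V -> option S} := [ffun=> None].
have -> : [set psi | good psi] = ext phi0.
  apply/setP=> psi; rewrite !inE andb_idr // => _.
  by apply/forallP => v; rewrite ffunE.
have vac0 : vac phi0 = setT.
  by apply/setP=> s; rewrite !inE; apply/forallP => v; rewrite ffunE.
have roots0 : roots phi0 = setT by apply/setP=> v; rewrite !inE ffunE.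
rewrite (@card_ext_acyclic #|V|.-1) ?vac0 ?roots0 ?cardsT ?prednK //.
  by move=> u v s; rewrite ffunE.
by move=> v; exists v; rewrite ?ffunE // /leads connect0.
Qed.

End Completions.

(** * Rooted forests and parent functions *)

Lemma set2_eq (T : finType) (a b c d : T) :
  [set a; b] = [set c; d] -> a = c /\ b = d \/ a = d /\ b = c.
Proof.
move=> /setP e; move: (e a) (e b) (e c) (e d); rewrite !inE !eqxx !orbT /=.
move=> /esym/orP[]/eqP-> /esym/orP[]/eqP->; rewrite ?eqxx ?orbT /=; auto.
  by move=> _; rewrite orbb => /eqP->; auto.
by rewrite orbb => /eqP->; auto.
Qed.

Lemma adj_sym (V : finType) (F : {set {set V}}) : symmetric (adj F).
Proof. by move=> u v; rewrite /adj /= eq_sym setUC. Qed.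

Definition parent_edges (V : finType) (R : {set V}) (f : V -> V) : {set {set V}} :=
  [set [set v; f v] | v in ~: R].

Section ParentForest.
Variables (V : finType) (R : {set V}) (f : V -> V) (h : V -> nat).
Hypothesis hf : forall v, v \notin R -> h (f v) < h v.

Let F := parent_edges R f.

Lemma parent_neq v : v \notin R -> f v != v.
Proof. by move=> /hf; apply: contraTneq => ->; rewrite ltnn. Qed.

Lemma adj_parent u v :
  adj F u v = (u \notin R) && (f u == v) || (v \notin R) && (f v == u).
Proof.
apply/andP/orP => [[_ /imsetP[x]]|].
  by rewrite inE => nx /set2_eq[[-> ->]|[-> ->]]; rewrite nx eqxx; auto.
case=> /andP[nR /eqP<-]; last rewrite eq_sym setUC; rewrite eq_sym parent_neq //;
  by split => //; apply/imsetP; eexists; rewrite ?inE; first exact: nR.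
Qed.

Lemma parent_ind (P : V -> Prop) :
  (forall r, r \in R -> P r) -> (forall v, v \notin R -> P (f v) -> P v) ->
  forall v, P v.
Proof.
move=> PR Pf v; have [n] := ubnP (h v); elim: n v => // n IHn v lt_hn.
have [/PR //|nv] := boolP (v \in R).
by apply: Pf => //; apply: IHn; apply: leq_trans (hf nv) _.
Qed.

Lemma connect_root v : exists2 r, r \in R & connect (adj F) r v.
Proof.
elim/parent_ind: v => [r Rr|v nv [r Rr rv]]; first by exists r; rewrite ?connect0.
exists r => //; apply: connect_trans rv (connect1 _).
by rewrite adj_parent nv eqxx orbT.
Qed.

(* A vertex of maximal height on a cycle would have its parent as both its
   neighbours. *)
Lemma acyclic_parent : acyclic F.
Proof.
apply/acyclicP => c /andP[cyc uc]; rewrite leqNgt; apply/negP => c_gt2.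
have [x0 x0c] : exists x, x \in c
  by case: (c) c_gt2 => // x s _; exists x; rewrite mem_head.
case: (@arg_maxnP _ x0 [in c] h x0c) => x xc xmax.
have [i s es] := rot_to xc.
have := cyc; rewrite -(rot_cycle i) es.
have := uc; rewrite -(rot_uniq i) es.
have sc : {subset s <= c}.
  by move=> y ys; rewrite -(mem_rot i) es inE ys orbT.
have : 1 < size s by move: c_gt2; rewrite -(size_rot i) es.
have nbr y : y \in s -> adj F x y -> y = f x.
  move=> /sc yc; rewrite adj_parent => /orP[/andP[_ /eqP//]|/andP[ny /eqP e]].
  by have := xmax y yc; rewrite /= -e leqNgt hf.
case: s {es sc} nbr => [|y s] // nbr; case/lastP: s nbr => [|s z] // nbr _.
rewrite /= rcons_path last_rcons => /andP[_ us] /andP[xy /andP[_ zx]].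
have ey := nbr y (mem_head _ _) xy.
have ez : z = f x by apply: nbr; rewrite ?inE ?mem_rcons ?mem_head ?orbT // adj_sym.
by move: us; rewrite ey -ez mem_rcons mem_head.
Qed.

(** Freezing the roots makes every walk through the parents come to rest, so two roots reached from
    one vertex coincide. *)
Let g v := if v \in R then v else f v.

Lemma connect_root_fconnect r v : r \in R -> connect (adj F) r v -> fconnect g v r.
Proof.
move=> Rr /connectP[p + ->]; have : fconnect g r r by apply: connect0.
have gr : g r = r by rewrite /g Rr.
elim: p {1 3 4}r => [|y p IHp] x xr //= /andP[xy]; apply: IHp.
move: xy; rewrite adj_parent => /orP[]/andP[nR /eqP e].
  have gx : g x = y by rewrite /g (negbTE nR).
  move: xr => /iter_findex; case: (findex _ _ _) => [/= ex|n].
    by rewrite -ex -gx ex gr connect0.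
  by rewrite iterSr gx => <-; apply: fconnect_iter.
by apply: connect_trans xr; rewrite -e; have := fconnect1 g y;
  rewrite {2}/g (negbTE nR).
Qed.

Lemma rooted_forest_parent : rooted_forest F R.
Proof.
apply/andP; split; first exact: acyclic_parent.
apply/forallP => v; apply/cards1P; have [r Rr rv] := connect_root v.
exists r; apply/setP => q; rewrite !inE; apply/andP/eqP => [[Rq qv]|->//].
have gfix x n : x \in R -> iter n g x = x.
  by move=> Rx; elim: n => //= n ->; rewrite /g Rx.
have /iter_findex er := connect_root_fconnect Rr rv.
have /iter_findex eq := connect_root_fconnect Rq qv.
rewrite -(gfix _ (findex g v r) Rq) -eq -iterD addnC iterD er.
exact: gfix.
Qed.

(** A simple path from a root only goes from parent to child, since a step back to the parent would
    repeat the preceding vertex. *)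
Lemma rooted_path_parent r p w : r \in R -> path (adj F) r (rcons p w) ->
  uniq (r :: rcons p w) -> (w \notin R) && (f w == last r p).
Proof.
move=> Rr; elim/last_ind: p w => [|p v IHp] w.
  by rewrite /= andbT adj_parent Rr.
rewrite rcons_path last_rcons -rcons_cons rcons_uniq => /andP[pv vw] /andP[nw uv].
have /andP[nv /eqP ev] := IHp v pv uv.
move: vw; rewrite adj_parent nv ev => /orP[/eqP ew|//].
by rewrite -rcons_cons mem_rcons inE -ew mem_last orbT in nw.
Qed.

Lemma children_parent v : children F R v = [set w | (w \notin R) && (f w == v)].
Proof.
apply/setP => w; rewrite [in RHS]inE; apply/childrenP/andP.
  by case=> r Rr [p [pw uw <-]]; apply/andP; exact: rooted_path_parent pw uw.
case=> nw /eqP <-.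
(* The heights on the path are bounded by that of its end, so that appending a child keeps it
   simple. *)
have [r Rr [p [pp up lp hp]]] : exists2 r, r \in R & exists p,
    [/\ path (adj F) r p, uniq (r :: p), last r p = f w &
        all (fun x => h x <= h (f w)) (r :: p)].
  elim/parent_ind: (f w) => [r Rr|x nx [r Rr [p [pp up lp hp]]]].
    by exists r => //; exists [::]; rewrite /= leqnn.
  exists r => //; exists (rcons p x).
  rewrite rcons_path pp lp adj_parent nx eqxx orbT last_rcons -rcons_cons.
  rewrite rcons_uniq up all_rcons leqnn andbT /= -/(all _ (r :: p)); split => //.
    by rewrite andbT; apply/negP => /(allP hp _) /=; rewrite leqNgt hf.
  by apply: sub_all hp => y /leq_trans; apply; exact/ltnW/hf.
exists r => //; exists p.
rewrite rcons_path pp lp adj_parent nw eqxx orbT -rcons_cons rcons_uniq up andbT.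
by rewrite andbT; split => //; apply/negP => /(allP hp _) /=; rewrite leqNgt hf.
Qed.

End ParentForest.

(* Height is the distance to the roots. *)
Lemma rooted_forest_height (V : finType) (F : {set {set V}}) (R : {set V}) :
  rooted_forest F R ->
  exists h : V -> nat, forall v, v \notin R -> exists2 u, adj F u v & h u < h v.
Proof.
case/andP=> _ /forallP one.
pose P v m := [exists r in R, exists p : m.-tuple V,
  path (adj F) r p && (last r p == v)].
have exP v : exists m, P v m.
  have /card_gt0P[r] : 0 < #|[set r in R | connect (adj F) r v]| by rewrite (eqP (one v)).
  rewrite inE => /andP[Rr /connectP[p pp ->]]; exists (size p).
  by apply/exists_inP; exists r => //; apply/existsP; exists (in_tuple p);
    rewrite pp eqxx.
exists (fun v => ex_minn (exP v)) => v nv.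
case: (ex_minnP (exP v)) => m /exists_inP[r Rr /existsP[[p /= /eqP <-] /andP[]]] + /eqP + _.
case/lastP: p => [|p w]; first by move=> _ /= e; rewrite -e Rr in nv.
rewrite rcons_path last_rcons size_rcons => /andP[pp uw] <-; exists (last r p) => //.
case: ex_minnP => n _; rewrite ltnS; apply.
by apply/exists_inP; exists r => //; apply/existsP; exists (in_tuple p);
    rewrite pp eqxx.
Qed.

(** The parent is a neighbour of smaller height. Each component of [F] has one root, so an edge of
    [F] missed by the parent edges would join two vertices of one parent tree and close a cycle of
    length at least three. *)
Lemma rooted_forest_parentE (V : finType) (F : {set {set V}}) (R : {set V}) :
  F \subset pairs [set: V] -> rooted_forest F R ->
  exists f, exists2 h : V -> nat,
    forall v, v \notin R -> h (f v) < h v & F = parent_edges R f.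
Proof.
move=> Fpairs rF; have [h ex_par] := rooted_forest_height rF.
pose f v := odflt v [pick u | adj F u v && (h u < h v)].
have fP v : v \notin R -> adj F (f v) v /\ h (f v) < h v.
  move=> /ex_par[u uv hu]; rewrite /f; case: pickP => [x /andP[]//|/(_ u)].
  by rewrite uv hu.
have hf v : v \notin R -> h (f v) < h v by move=> /fP[].
exists f, h => //.
have sub : parent_edges R f \subset F.
  apply/subsetP => _ /imsetP[v + ->]; rewrite inE => /fP[/andP[_ +] _].
  by rewrite setUC.
apply/eqP; rewrite eqEsubset sub andbT; apply/subsetP => e eF.
apply: contraT => neF; have := subsetP Fpairs e eF.
rewrite inE => /andP[_ /cards2P[u [w [nuw eE]]]].
have sub_adj : subrel (adj (parent_edges R f)) (adj F).
  by move=> x y /andP[/= xy /(subsetP sub) xyF]; apply/andP; split.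
have sub_conn := connect_sub (fun x y xy => connect1 (sub_adj x y xy)).
case/andP: rF => /acyclicP acycF /forallP one.
have [r Rr ru] := connect_root hf u; have [q Rq qw] := connect_root hf w.
have uwF : adj F u w by rewrite /adj /= nuw -eE.
have er : r = q.
  have /eqP/cards1P[x /setP ex] := eqP (one w).
  have := ex r; have := ex q; rewrite !inE Rr Rq (sub_conn _ _ qw).
  rewrite (connect_trans (sub_conn _ _ ru) (connect1 uwF)) /=.
  by move=> /esym/eqP-> /esym/eqP->.
have /connectP[p0 pp0 lp0] : connect (adj (parent_edges R f)) u w.
  apply: connect_trans qw; by rewrite -er (sym_connect_sym (@adj_sym _ _)).
case/shortenP: pp0 lp0 => p pp up _ lp.
have : ucycle (adj F) (u :: p).
  rewrite /ucycle up /= rcons_path (sub_path sub_adj pp) -lp /adj /=.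
  by rewrite eq_sym nuw setUC -eE eF.
move/acycF; case: p pp up lp => [|y [|]] //=.
  by move=> _ _ wu; rewrite wu eqxx in nuw.
by rewrite andbT => /andP[_ +] _ wy; rewrite -wy -eE (negbTE neF).
Qed.

Lemma pair_ext (A B : Type) (x y : A * B) : x.1 = y.1 -> x.2 = y.2 -> x = y.
Proof. by case: x y => [a b] [c d] /= -> ->. Qed.

Lemma in_pairs (T : finType) (A : {set T}) (u v : T) : v != u ->
  ([set u; v] \in pairs A) = (u \in A) && (v \in A).
Proof. by rewrite eq_sym inE cards2 => ->; rewrite andbT subUset !sub1set. Qed.

(** * Cycle-rooted trees as injections into the slots *)

Section Encoding.
Variables (k : nat) (V : finType).

Let tree := ({set {set V}} * {set V} * {perm V}
             * {ffun V -> {ffun V -> option 'I_k.+1}})%type.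
Let code := {ffun V -> V * 'I_k.+1}.

Let own : V * 'I_k.+1 -> V := fst.
Let spec (v : V) : V * 'I_k.+1 := (v, ord_max).

(** The graph of the bijection, kept as a relation because it concerns only valid trees and good
    injections. The roots are the vertices on cycles of [f], and [o] is [f] on them. *)
Definition encodes (t : tree) (psi : code) : Prop :=
  let: (E, R, o, l) := t in
  let f := own \o psi in
  [/\ R = [set v | fconnect f (f v) v],
      E = [set [set v; f v] | v : V & f v != v],
      forall v, o v = if v \in R then f v else v,
      forall v j, l v j = if (j \notin R) && (f j == v) then Some (psi j).2 else None
    & forall r, r \in R -> (psi r).2 = ord_max].

Lemma encodes_inj (t t' : tree) (psi : code) :
  encodes t psi -> encodes t' psi -> t = t'.
Proof.
move: t t' => [[[E R] o] l] [[[E' R'] o'] l'].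
move=> [eR -> oE lE _] [eR' -> oE' lE' _]; rewrite -eR in eR'.
have -> : o = o' by apply/permP => v; rewrite oE oE' eR'.
have -> : l = l' by apply/ffunP => v; apply/ffunP => j; rewrite lE lE' eR'.
by rewrite eR'.
Qed.

(** A root goes to the last slot of its image under [o]; any other [j] has a label at one [v] only,
    which is its parent. *)
Lemma encodes_fun (t : tree) (psi psi' : code) :
  encodes t psi -> encodes t psi' -> psi = psi'.
Proof.
move: t => [[[E R] o] l] [_ _ oE lE mE] [_ _ oE' lE' mE']; apply/ffunP => j.
have [Rj|nRj] := boolP (j \in R).
  have := oE' j; rewrite oE Rj /= => e.
  by apply: pair_ext; rewrite ?mE ?mE'.
have := lE' (own (psi j)) j; rewrite lE nRj /= eqxx.
by case: eqP => //= e [e']; apply: pair_ext.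
Qed.

Lemma special_max (s : V * 'I_k.+1) : special own spec s = (s.2 == ord_max).
Proof.
by case: s => v p; rewrite /special /spec /= xpair_eqE eqxx /= eq_sym.
Qed.

Lemma good_tree (psi : code) : good own spec psi ->
  exists2 t : tree, t \in cycle_rooted_trees k.+1 V & encodes t psi.
Proof.
case/andP=> /injectiveP psi_inj /existsP[c /andP[/forallP leadc /forallP spc]].
set f := own \o psi in leadc spc.
have [R eR] : exists R, R = [set v | fconnect f (f v) v] by eexists.
(* Every vertex leads to [c], so lying on a cycle amounts to being reachable from [c]. *)
have RE v : (v \in R) = fconnect f c v.
  rewrite eR inE; apply/idP/idP => [vv|cv]; last exact: connect_trans (leadc _) cv.
  apply: (fconnect_closed (P := fconnect f ^~ v)) (leadc v); last exact: connect0.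
  by move=> z; rewrite (fconnect_step _ z) => /orP[/eqP->|].
have maxR v : v \in R -> (psi v).2 = ord_max.
  by rewrite RE => cv; apply/eqP; rewrite -special_max; have := spc v; rewrite cv.
have fR v : v \in R -> f v \in R.
  by rewrite !RE => /connect_trans; apply; apply: fconnect1.
pose ofun v := if v \in R then f v else v.
have ofun_inj : injective ofun.
  move=> u v; rewrite /ofun; case: (boolP (u \in R)) => Ru; case: (boolP (v \in R)) => Rv //.
  - move=> e; apply: psi_inj.
    by apply: pair_ext; rewrite ?maxR.
  - by move=> e; rewrite -e fR in Rv.
  - by move=> e; rewrite e fR in Ru.
pose o := perm ofun_inj.
have oE v : o v = if v \in R then f v else v by rewrite permE.
pose l : {ffun V -> {ffun V -> option 'I_k.+1}} := [ffun v => [ffun j =>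
  if (j \notin R) && (f j == v) then Some (psi j).2 else None]].
have lE v j : l v j = if (j \notin R) && (f j == v) then Some (psi j).2 else None.
  by rewrite !ffunE.
pose E := [set [set v; f v] | v : V & f v != v].
(* The number of reachable vertices serves as height: off the cycle, a step to the parent loses [v]
   itself. *)
have hf v : v \notin R -> #|fconnect f (f v)| < #|fconnect f v|.
  move=> nv; apply: proper_card; apply/properP; split.
    by apply/subsetP => w; apply: connect_trans; apply: fconnect1.
  by exists v; [apply: connect0 | rewrite eR inE in nv].
have EmR : E :\: pairs R = parent_edges R f.
  apply/setP => e; rewrite inE; apply/andP/imsetP.
    case=> + /imsetP[v + ee]; rewrite {}ee inE => + fv; rewrite in_pairs // => nR.
    by exists v => //; rewrite inE; apply: contraNN nR => Rv; rewrite Rv fR.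
  case=> v; rewrite inE => nv ->; have fv := parent_neq hf nv.
  by split; [rewrite in_pairs // (negbTE nv) | apply: imset_f; rewrite inE].
have chE v : tree_children E R v = [set w | (w \notin R) && (f w == v)].
  by rewrite /tree_children EmR (children_parent hf).
exists (E, R, o, l); last by split.
rewrite inE; apply/and5P; split; last (apply/andP; split).
- apply/andP; split; first by apply/set0Pn; exists c; rewrite RE connect0.
  apply/subsetP => _ /imsetP[v + ->]; rewrite inE => fv.
  by rewrite in_pairs ?inE.
- apply/andP; split.
    apply/andP; split.
      by apply/subsetP => v; rewrite inE oE; case: ifP => //; rewrite eqxx.
    apply/forall_inP => r Rr; apply/eqP/setP => v.
    have it i : (o ^+ i)%g r = iter i f r.
      have itR : iter i f r \in R by elim: i => //= i; apply: fR.
      rewrite permX; elim: i itR => //= i IHi _.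
      have itR : iter i f r \in R by elim: (i) => //= j; apply: fR.
      by rewrite IHi // oE itR.
    have rc : fconnect f r =1 fconnect f c.
      move=> w; apply/idP/idP; last exact: connect_trans (leadc r).
      by apply: connect_trans; rewrite -RE.
    rewrite RE -rc; apply/porbitP/idP => [[i ->]|/iter_findex <-].
      by rewrite it fconnect_iter.
    by exists (findex f r v); rewrite it.
  apply/eqP/setP => e; rewrite inE; apply/andP/imsetP.
    case=> /imsetP[v]; rewrite inE => fv ->; rewrite in_pairs // => /andP[Rv _].
    by exists v; rewrite ?inE oE Rv // eq_sym.
  case=> r; rewrite inE oE => /andP[Rr]; rewrite Rr eq_sym => nr ->; split.
    by apply: imset_f; rewrite inE.
  by rewrite in_pairs // Rr fR.
- by rewrite EmR (rooted_forest_parent hf).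
- apply/forallP => v; rewrite chE -[k.+1]card_ord.
  apply: (@leq_card_in _ _ (fun j => (psi j).2)) => u w.
  rewrite !inE => /andP[_ /eqP eu] /andP[_ /eqP ew] e; apply: psi_inj.
  by apply: pair_ext; rewrite // [LHS]eu -ew.
- apply/forallP => v; apply/andP; split.
    by apply/forallP => j; rewrite chE lE inE; case: ifP.
  apply/dinjectiveP => u w; rewrite chE !inE !lE => hu hw.
  rewrite hu hw; move: hu hw => /andP[_ /eqP eu] /andP[_ /eqP ew] [e]; apply: psi_inj.
  by apply: pair_ext; rewrite // [LHS]eu -ew.
- apply/forall_inP => r Rr; apply/forallP => p; apply/implyP => /eqP[pk].
  apply/negP => /existsP[j /andP[]]; rewrite chE lE inE => hj; rewrite hj => /eqP[ep].
  case/andP: hj => nj /eqP ej.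
  (* The cycle predecessor [q] of [r] already holds the last slot of [r], so [j] would be the root
     [q]. *)
  have /codomP[q eq_r] : r \in codom o by rewrite perm_onto.
  rewrite oE in eq_r; case: ifP eq_r => [Rq eq_r|nq eq_r]; last by rewrite -eq_r Rr in nq.
  have ejq : j = q.
    apply: psi_inj; apply: pair_ext; first by rewrite [LHS]ej.
    by rewrite ep maxR //; apply: val_inj.
  by rewrite ejq Rq in nj.
Qed.

Lemma tree_good (t : tree) : t \in cycle_rooted_trees k.+1 V ->
  exists2 psi : code, good own spec psi & encodes t psi.
Proof.
case: t => [[[E R] o] l]; rewrite inE.
case/and5P=> /andP[/set0Pn[c Rc] Epairs] /andP[/andP[on_o /forall_inP cyc] /eqP ER]
  rF _ /andP[/forallP slots /forall_inP vacR].
have Fpairs : E :\: pairs R \subset pairs [set: V].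
  by apply: subset_trans Epairs; apply: subsetDl.
have [f0 [h hf0 FE]] := rooted_forest_parentE Fpairs rF.
have chE v : tree_children E R v = [set w | (w \notin R) && (f0 w == v)].
  by rewrite /tree_children FE (children_parent hf0).
have oR v : v \in R -> o v \in R.
  by move=> Rv; rewrite (perm_closed _ on_o).
have oN v : v \notin R -> o v = v by apply: out_perm.
pose psi : code := [ffun j => if j \in R then (o j, ord_max)
  else (f0 j, odflt ord_max (l (f0 j) j))].
set f := own \o psi.
have fE v : f v = if v \in R then o v else f0 v by rewrite /f /= ffunE; case: ifP.
have maxR r : r \in R -> (psi r).2 = ord_max by move=> Rr; rewrite ffunE Rr.
have lE v j : l v j = if (j \notin R) && (f j == v) then Some (psi j).2 else None.
  have /andP[/forallP/(_ j)] := slots v; rewrite chE inE fE ffunE.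
  case: (j \in R) => /=; first by case: (l v j).
  by case: (f0 j =P v) => [<-|_]; [case: (l (f0 j) j) | case: (l v j)].
have porbit_lead u v : u \in R -> v \in R -> fconnect f u v.
  move=> Ru; rewrite -(eqP (cyc u Ru)) => /porbitP[i ->].
  have [-> _] : (o ^+ i)%g u = iter i f u /\ iter i f u \in R.
    rewrite permX; elim: i => //= i [-> Ri].
    by rewrite fE Ri; split => //; apply: oR.
  exact: fconnect_iter.
have RE : R = [set v | fconnect f (f v) v].
  apply/setP => v; rewrite inE; apply/idP/idP => [Rv|vv].
    by apply: porbit_lead => //; rewrite fE Rv oR.
  (* Off [R] the height drops strictly and [R] is never left, so no walk returns to such a [v]. *)
  apply: contraTT vv => nv; apply/negP => vv.
  have : (v \in R) || (h v < h v).
    apply: (fconnect_closed (P := fun y => (y \in R) || (h y < h v))) vv.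
      move=> z; rewrite fE; case: (boolP (z \in R)) => [/oR -> //|nz] /= lt_hz.
      by rewrite (ltn_trans (hf0 z nz) lt_hz) orbT.
    by rewrite fE (negbTE nv) hf0 ?orbT.
  by rewrite (negbTE nv) ltnn.
exists psi; last first.
  split => // [|v]; last by rewrite -/f fE; case: (boolP (v \in R)) => // /oN.
  have -> : E = (E :&: pairs R) :|: (E :\: pairs R) by rewrite setID.
  rewrite ER FE; apply/setP => e; rewrite inE; apply/orP/imsetP.
    case=> /imsetP[v]; rewrite inE.
      by case/andP=> Rv nv ->; exists v; rewrite ?inE -/f fE Rv // eq_sym.
    by move=> nv ->; exists v; rewrite ?inE -/f fE (negbTE nv) // (parent_neq hf0).
  case=> v; rewrite inE -/f fE; case: (boolP (v \in R)) => Rv nv ->.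
    by left; apply: imset_f; rewrite inE Rv eq_sym.
  by right; apply: imset_f; rewrite inE.
(* Roots are sent to last slots of roots, which condition (6) keeps free of all other vertices. *)
have clash u v : u \in R -> v \notin R -> psi u <> psi v.
  move=> Ru nv e; have maxv : (psi v).2 = ord_max by rewrite -e maxR.
  have fuv : f v = o u by rewrite /f /= -e ffunE Ru.
  have /forallP/(_ ord_max)/implyP/(_ (eqxx _))/negP := vacR _ (oR u Ru); apply.
  apply/existsP; exists v; rewrite /occupied chE inE nv lE nv fuv eqxx maxv eqxx andbT.
  by rewrite -fuv fE (negbTE nv) eqxx.
apply/andP; split.
  apply/injectiveP => u v e.
  have [Ru|nu] := boolP (u \in R); have [Rv|nv] := boolP (v \in R).
  - have : f u = f v by rewrite /f /= e.
    by rewrite !fE Ru Rv => /perm_inj.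
  - by case: (clash u v Ru nv).
  - by case: (clash v u Rv nu).
  have fuv : f u = f v by rewrite /f /= e.
  have /andP[_ /dinjectiveP inj] := slots (f v); apply: inj.
  - by rewrite chE inE nu -fuv fE (negbTE nu) eqxx.
  - by rewrite chE inE nv fE (negbTE nv) eqxx.
  by rewrite !lE nu nv fuv eqxx e.
apply/existsP; exists c; apply/andP; split; apply/forallP => v.
  elim/(parent_ind hf0): v => [r Rr|v nv vc]; first exact: porbit_lead.
  by rewrite fconnect_step -/f fE (negbTE nv) vc orbT.
apply/implyP => cv; rewrite special_max maxR //.
apply: (fconnect_closed (P := [in R])) cv => // z Rz.
by rewrite -/f fE (Rz : z \in R); apply: oR.
Qed.

End Encoding.

(** * The number of cycle-rooted trees *)

Lemma leq_card_rel (T U : finType) (A : {set T}) (B : {set U}) (P : T -> U -> Prop) :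
  (forall x, x \in A -> exists2 y, y \in B & P x y) ->
  (forall x x' y, P x y -> P x' y -> x = x') -> #|A| <= #|B|.
Proof.
move=> AB inj; have [->|[x0 /AB[y0 _ _]]] := set_0Vmem A; first by rewrite cards0.
have /fin_all_exists[g gP] x : exists y, x \in A -> y \in B /\ P x y.
  by case: (boolP (x \in A)) => [/AB[y]|]; [exists y | exists y0].
have g_inj : {in A &, injective g}.
  by move=> x x' /gP[_ Px] /gP[_ Px'] e; apply: inj Px _; rewrite e.
rewrite -(card_in_imset g_inj); apply/subset_leq_card/subsetP => _ /imsetP[x /gP[yB _] ->].
by [].
Qed.

(** The relation [encodes], read in both directions, gives two inequalities between the trees and
    the good injections into the [k * #|V|] slots. *)
Lemma card_cycle_rooted_trees (k : nat) (V : finType) : 0 < k -> 0 < #|V| ->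
  #|cycle_rooted_trees k V| = (k * #|V|).-1 ^_ #|V|.-1.
Proof.
case: k => // k _ V_gt0.
have specK : cancel (fun v : V => (v, @ord_max k)) fst by [].
rewrite mulnC -[k.+1 in RHS]card_ord -card_prod -(card_good specK V_gt0).
apply/eqP; rewrite eqn_leq; apply/andP; split.
  apply: (@leq_card_rel _ _ _ _ (@encodes k V)) => [t /tree_good[psi gpsi tpsi]|].
    by exists psi; rewrite ?inE.
  exact: encodes_inj.
apply: (@leq_card_rel _ _ _ _ (fun psi t => @encodes k V t psi)) => [psi|psi psi' t].
  by rewrite inE => /good_tree[t]; exists t.
exact: encodes_fun.
Qed.

(** * The Rothe-Hagen convolution *)

Local Open Scope ring_scope.

(* The coefficient of degree m of G_k^y, that is y/(y+km) C(y+km, m). *)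
Definition hagen (k y m : nat) : rat :=
  if m is m'.+1 then y%:R / m%:R * 'C(y + k * m - 1, m')%:R else 1.

Arguments hagen : simpl never.

Lemma natrS_neq0 (n : nat) : n.+1%:R != 0 :> rat.
Proof. by rewrite pnatr_eq0. Qed.

(** Coefficient form of G^(y+1) = G^y + x G^(y+k), which reflects G = 1 + x G^k; it is checked
    directly on binomials. *)
Lemma hagenS (k y m : nat) : (0 < k)%N ->
  hagen k y.+1 m.+1 = hagen k y m.+1 + hagen k (y + k) m.
Proof.
rewrite /hagen => k_gt0; case: m => [|m].
  by rewrite !bin0 -natr1; field.
set N := (y + k * m.+2 - 1)%N.
have -> : (y.+1 + k * m.+2 - 1 = N.+1)%N by rewrite /N; nia.
have -> : (y + k + k * m.+1 - 1 = N)%N by rewrite /N; nia.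
have eN : N%:R = y%:R + k%:R * m.+2%:R - 1 :> rat.
  by rewrite /N natrB ?natrD ?natrM //; nia.
have lNm : (m <= N)%N by rewrite /N; nia.
have eC : 'C(N, m.+1)%:R = (N%:R - m%:R) / m.+1%:R * 'C(N, m)%:R :> rat.
  have := congr1 (GRing.natmul 1 : nat -> rat) (mul_bin_left N m).
  rewrite !natrM natrB // => e.
  by apply: (mulfI (natrS_neq0 m)); rewrite e mulrA mulrCA divff ?mulr1 ?natrS_neq0.
rewrite binS natrD eC eN !natrD -[y.+1]addn1 -[m.+2]addn2 -[m.+1]addn1 !natrD.
have m1 : m%:R + 1 != 0 :> rat by rewrite natr1 natrS_neq0.
have m2 : m%:R + 2 != 0 :> rat by rewrite -natrD addn2 natrS_neq0.
field.
by rewrite m1 m2.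
Qed.

Lemma subSn_ord (n : nat) (j : 'I_n.+1) : (n.+1 - j = (n - j).+1)%N.
Proof. by rewrite subSn // -ltnS. Qed.

(** Induction on [n], then on [y]. For [y = 0] only the term [j = n] survives; the step in [y]
    splits each term by [hagenS], and the two sums recombine by Pascal's rule. *)
Lemma hagen_conv (k n y : nat) : (0 < k)%N ->
  \sum_(j < n.+1) 'C(k * j, j)%:R * hagen k y (n - j)%N = 'C(y + k * n, n)%:R.
Proof.
move=> k_gt0; elim: n y => [|n IHn] y.
  by rewrite big_ord1 /= !bin0 mulr1.
elim: y => [|y IHy].
  rewrite big_ord_recr big1 /= ?subnn /= ?mulr1 ?add0r ?add0n // => j _.
  by rewrite /= subSn_ord /hagen !mul0r mulr0.
rewrite big_ord_recr /= subnn /= in IHy; rewrite big_ord_recr /= subnn /=.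
under eq_bigr => j _ do rewrite subSn_ord hagenS // mulrDr.
rewrite big_split /= addrAC IHn.
under eq_bigr => j _ do rewrite -subSn_ord.
rewrite {}IHy addSn binS natrD; congr (_ + 'C(_, _)%:R).
by rewrite mulnS addnA.
Qed.

Lemma hagen1 (k m : nat) : hagen k 1 m = G k m.
Proof. by case: m => [|m] //; rewrite /hagen /G /= add1n subn1 mul1r. Qed.

(** The case [y = 1] without its term of index 0, divided by [k]. It says that the expected
    coefficients of the logarithm satisfy G (log G)' = G'. *)
Lemma G_conv (k n : nat) : (0 < k)%N ->
  \sum_(j < n.+1) 'C(k * j.+1 - 1, j)%:R * G k (n - j)%N = n.+1%:R * G k n.+1.
Proof.
move=> k_gt0; have := hagen_conv n.+1 1 k_gt0.
rewrite big_ord_recl /= muln0 bin0 mul1r -/(hagen k 1 n.+1) hagen1.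
have -> : 'C(1 + k * n.+1, n.+1)%:R = (1 + k%:R * n.+1%:R) * G k n.+1.
  rewrite /G /= -natrM -mulrS mulrA mulrAC -natrM add1n mul_bin_diag natrM.
  by rewrite mulrAC divff ?natrS_neq0 ?mul1r.
under eq_bigr => j _.
  rewrite /bump leq0n add1n subSS hagen1.
  have -> : 'C(k * j.+1, j.+1)%:R = k%:R * 'C(k * j.+1 - 1, j)%:R :> rat.
    apply: (mulfI (natrS_neq0 j)); rewrite -!natrM -mul_bin_diag subn1.
    by rewrite mulnA [(k * _)%N]mulnC.
  rewrite -mulrA; over.
rewrite -mulr_sumr mulrDl mul1r => /addrI; rewrite -mulrA.
by apply: mulfI; rewrite pnatr_eq0 -lt0n.
Qed.

(** * The logarithmic derivative of a power series *)

Section LogDerivative.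
Variables (f : fps).
Hypothesis f0 : f 0%N = 1.

Let u : fps := fps_sub f fps_one.

Let u0 : u 0%N = 0.
Proof. by rewrite /u /fps_sub f0 subrr. Qed.

Variable N : nat.
(** Truncation gives access to derivatives of polynomials and does not affect coefficients of degree
    below [N]. *)
Let p : {poly rat} := \poly_(i < N) u i.
Let L : {poly rat} := \sum_(1 <= m < N.+1) ((-1) ^+ m.-1 / m%:R) *: p ^+ m.

Lemma fps_exp_coef (m i : nat) : (i < N)%N -> fps_exp u m i = (p ^+ m)`_i.
Proof.
elim: m i => [|m IHm] i lt_iN; first by rewrite expr0 coef1.
rewrite exprS coefM /fps_exp iterS; apply: eq_bigr => j _.
rewrite -/(fps_exp u m) IHm ?coef_poly ?ifT //.
  exact: leq_trans (ltn_ord j) lt_iN.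
exact: leq_ltn_trans (leq_subr _ _) lt_iN.
Qed.

Lemma fps_log_coef (n : nat) : (n < N)%N -> fps_log f n = L`_n.
Proof.
move=> lt_nN; rewrite /fps_log coef_sum.
rewrite [RHS](@big_cat_nat _ _ _ n.+1) //=; last exact: leqW.
rewrite [X in _ + X]big1_seq ?addr0 => [|m].
  by apply: eq_bigr => m _; rewrite coefZ fps_exp_coef.
rewrite mem_index_iota => /andP[_ /andP[lt_nm _]].
by rewrite coefZ -fps_exp_coef // fps_exp_low ?mulr0.
Qed.

(** The derivative of the truncated logarithm is a geometric sum in [- p] times the derivative of
    [p]; the factor [1 + p] makes the sum telescope. *)
Lemma fps_log_deriv_poly : (1 + p) * L^`() = (1 - (- p) ^+ N) * p^`().
Proof.
have -> : L^`() = (\sum_(i < N) (- p) ^+ i) * p^`().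
  rewrite raddf_sum big_add1 /= big_mkord mulr_suml; apply: eq_bigr => m _.
  rewrite derivZ deriv_exp -scaler_nat scalerA divfK ?natrS_neq0 //.
  by rewrite -[- p]scaleN1r exprZn -scalerAl mulrC.
rewrite mulrA; congr (_ * _).
have := subrX1 (- p) N; rewrite -opprB => e.
by rewrite -[RHS]opprK e -mulNr opprB opprK.
Qed.

(* The coefficient of degree n of (log f)' f = f'. *)
Lemma fps_log_deriv (n : nat) : (n.+1 < N)%N ->
  \sum_(j < n.+1) (j.+1%:R * fps_log f j.+1) * f (n - j)%N = n.+1%:R * f n.+1.
Proof.
move=> ltnN; have := congr1 (fun q : {poly rat} => q`_n) fps_log_deriv_poly.
rewrite mulrBl mul1r coefB coefMr.
rewrite [X in _ = _ - X]coefM [X in _ = _ - X]big1 ?subr0 => [|j _]; last first.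
  rewrite -[- p]scaleN1r exprZn coefZ -fps_exp_coef; last first.
    by exact: leq_trans (ltn_ord j) (ltnW ltnN).
  by rewrite fps_exp_low ?mulr0 ?mul0r //; exact: leq_trans (ltn_ord j) (ltnW ltnN).
rewrite coef_deriv coef_poly ltnN /u /fps_sub subr0 => e.
rewrite mulr_natl -e; apply: eq_bigr => j _.
have ltjN := leq_ltn_trans (ltn_ord j) ltnN.
rewrite coef_deriv -fps_log_coef // [RHS]mulrC -[X in _ = X * _]mulr_natl.
congr (_ * _).
have lt_njN : (n - j < N)%N by apply: leq_ltn_trans (leq_subr _ _) (ltnW ltnN).
by rewrite coefD coef1 coef_poly lt_njN addrC subrK.
Qed.

End LogDerivative.

(** * The coefficients of the logarithm and the conclusion *)

Lemma fps_log_G (k n : nat) : (0 < k)%N ->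
  fps_log (G k) n.+1 = 'C(k * n.+1 - 1, n)%:R / n.+1%:R.
Proof.
move=> k_gt0; apply: (mulfI (natrS_neq0 n)).
rewrite mulrCA divff ?natrS_neq0 // mulr1.
(* Both sequences satisfy the same recursion: the lower terms agree by induction and the top term
   has the factor [G k 0 = 1]. *)
elim/ltn_ind: n => n IHn; have := G_conv n k_gt0.
rewrite -(@fps_log_deriv (G k) (erefl _) n.+2) // !big_ord_recr /= subnn !mulr1.
rewrite (eq_bigr (fun j : 'I_n => j.+1%:R * fps_log (G k) j.+1 * G k (n - j)%N)).
  by move/addrI.
by move=> j _; rewrite IHn.
Qed.

Theorem theorem16 (k : nat) (hk : (2 <= k)%N) : fps_log (G k) =1 Ghat k.
Proof.
have k_gt0 : (0 < k)%N by apply: ltnW.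
case=> [|n]; first by rewrite /fps_log /Ghat big_geq.
rewrite fps_log_G // /Ghat /= card_cycle_rooted_trees ?card_ord //.
rewrite -subn1 -bin_ffact factS !natrM invfM mulrACA divff ?mulr1 //.
by rewrite pnatr_eq0 -lt0n fact_gt0.
Qed.
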